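(* Let $\mathcal{G}=(V,E)$ be a connected, non-bipartite, $d$-regular undirected graph on a finite vertex set $V$ with spectral gap $\beta$, let $F$ be a permutation of $V$, and let $\mathcal{G}'=(V,E')$ be the hybrid expander-permutation directed graph with $$E'=F\circ E=\{(u,F(v))\mid\{u,v\}\in E\}.$$ Let $t\ge 0$ be an integer, let $\Omega$ be the set of all directed $t$-walks $\mathbf{y}=(y_0,y_1,\dots,y_t)$ in $\mathcal{G}'$, let $\mathbb{P}$ be the uniform probability measure on $\Omega$, and for $0\le i\le t$ let $U_i:\Omega\to V$ be the projection function $U_i(\mathbf{y})=y_i$. Then $U_0,U_1,\dots,U_t$ are $\beta$-independent random objects.
   Context: The transition matrix of a $d$-regular undirected graph $\mathcal{G}$ on $N$ vertices is $\mathbf{A}=(a_{i,j})$ with $a_{i,j}=1/d$ if there is an edge from vertex $i$ to vertex $j$ and $a_{i,j}=0$ otherwise. Its eigenvalues are listed with multiplicity as $\lambda_0\ge\lambda_1\ge\cdots\ge\lambda_{N-1}$; when $\mathcal{G}$ is connected and non-bipartite, $\lambda_0=1$ is simple and all other eigenvalues have magnitude less than 1. The spectral gap is $\beta=1-\alpha$ where $\alpha=\max(|\lambda_1|,|\lambda_{N-1}|)$. A directed $t$-walk in $\mathcal{G}'$ is a $(t+1)$-tuple $(y_0,\dots,y_t)$ of (not necessarily distinct) vertices with $(y_i,y_{i+1})\in E'$ for all $0\le i<t$. Random objects $U_i$ ($0\le i\le t$) with values in the finite set $V$ (all subsets measurable) are $\beta$-independent if for all $T_i\subseteq V$, writing $\mu_i=\mathbb{P}\{U_i\in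 T_i\}$, $$\mathbb{P}\Big\{\bigwedge_{0\le i\le t}U_i\in T_i\Big\}\le\prod_{0\le i\le t}\big((1-\beta)+\beta\mu_i\big).$$ *)

(* Defs.v *)
From mathcomp Require Import all_boot all_order all_algebra all_fingroup.
From mathcomp Require Import reals.
From mathcomp Require Import polyrcf.
Set Implicit Arguments.
Unset Strict Implicit.
Unset Printing Implicit Defensive.
Import Order.TTheory GRing.Theory Num.Theory.
Local Open Scope ring_scope.

(* An undirected graph on V is a symmetric relation e; loops are not excluded
   (a loop at u counts once in the degree of u), multiple edges are. *)

Definition regular (V : finType) (e : rel V) (d : nat) : Prop :=
  forall u : V, #|[set v | e u v]| = d.

Definition connected (V : finType) (e : rel V) : Prop :=
  forall u v : V, connect e u v.

Definition bipartite (V : finType) (e : rel V) : Prop :=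
  exists c : V -> bool, forall u v : V, e u v -> c u != c v.

Definition transition_mx (R : realType) (V : finType) (e : rel V) (d : nat) :
    'M[R]_#|V| :=
  \matrix_(i, j) if e (enum_val i) (enum_val j) then d%:R^-1 else 0.

(* The real eigenvalues, in nonincreasing order, each repeated according to its
   multiplicity as a root of the characteristic polynomial.  For a symmetric
   matrix this list has exactly n elements. *)
Definition eigenvalues (R : realType) (n : nat) (A : 'M[R]_n) : seq R :=
  let p := char_poly A in
  sort >=%R (flatten [seq nseq (mup x p) x | x <- rootsR p]).

(* When #|V| = 1 there is no lambda_1 and the term lam`_1 is 0. *)
Definition spectral_gap (R : realType) (V : finType) (e : rel V) (d : nat) : R :=
  let lam := eigenvalues (transition_mx R e d) in
  1 - Num.max `|lam`_1| `|lam`_(#|V|.-1)|.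

Definition hybrid (V : finType) (e : rel V) (F : {perm V}) : rel V :=
  fun u w => [exists v, e u v && (w == F v)].

Notation walk e t := {y : t.+1.-tuple _ | sorted e y}.

Definition walk_proj (V : finType) (e : rel V) (t : nat) (i : 'I_t.+1)
    (y : walk e t) : V :=
  tnth (val y) i.

(* A probability measure on a finite set is given by its mass function. *)
Definition Pr (R : realType) (Omega : finType) (p : Omega -> R)
    (A : {set Omega}) : R :=
  \sum_(w in A) p w.

Definition uniform (R : realType) (Omega : finType) : Omega -> R :=
  fun=> #|Omega|%:R^-1.

Definition beta_independent (R : realType) (Omega V : finType) (p : Omega -> R)
    (beta : R) (t : nat) (U : 'I_t.+1 -> Omega -> V) : Prop :=
  forall T : 'I_t.+1 -> {set V},
    Pr p [set w | [forall i, U i w \in T i]] <=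
    \prod_(i < t.+1) ((1 - beta) + beta * Pr p [set w | U i w \in T i]).

(* Main.v *)
(* Write alpha = 1 - beta, J for the averaging operator and mu for the density of
   a set.  On functions of sum zero the transition matrix A contracts the l^2 norm
   by alpha, so A = beta J + E with |E| <= alpha, and for sets S and T
     |1_T A 1_S| <= alpha + beta sqrt(mu S mu T)
                 <= sqrt((alpha + beta mu S) (alpha + beta mu T))
   by Cauchy-Schwarz and AM-GM.  Composing A with F only replaces S by its preimage
   under F, which has the same density.  The probability that a walk is in T_i at
   every time i is <1, 1_(T_0) A' 1_(T_1) A' ... A' 1_(T_t)> / N, hence at most
   sqrt(mu T_0 mu T_t) times the product of the bounds for the t steps, and
   mu <= alpha + beta mu at both ends. *)
Require Import Defs.
From mathcomp Require Import all_boot all_order all_algebra all_fingroup.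
From mathcomp Require Import reals.
From mathcomp Require Import polyrcf complex ring lra.
Set Implicit Arguments.
Unset Strict Implicit.
Unset Printing Implicit Defensive.
Import Order.TTheory GRing.Theory Num.Theory.
Local Open Scope ring_scope.

(** * Spectra of symmetric stochastic matrices *)

Section SymmetricSpectrum.
Local Open Scope sesquilinear_scope.
Local Notation toC := (map_mx (real_complex _)).

Lemma char_poly_conj (F : fieldType) (n : nat) (P A B : 'M[F]_n) :
  P \in unitmx -> A = invmx P *m B *m P -> char_poly A = char_poly B.
Proof.
move=> Pu ->; rewrite /char_poly /char_poly_mx !map_mxM /=.
set Q := map_mx polyC P; set Qi := map_mx polyC (invmx P).
have QiQ : Qi *m Q = 1%:M by rewrite -map_mxM mulVmx// map_mx1.
rewrite [LHS](_ : _ = \det (Qi *m ('X%:M - map_mx polyC B) *m Q)); last first.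
  congr (\det _); rewrite mulmxBr mulmxBl; congr (_ - _).
  by rewrite scalar_mxC -mulmxA QiQ mulmx1.
by rewrite !det_mulmx mulrAC -det_mulmx QiQ det1 mul1r.
Qed.

(** Over [R[i]] the matrix is Hermitian, so the spectral theorem for normal matrices applies; the
    eigenvalues are real, so the factorisation of the characteristic polynomial descends to [R]. *)
Lemma symmetric_spectral (R : rcfType) (n : nat) (A : 'M[R]_n) :
  A^T = A ->
  exists (r : 'rV[R]_n) (U : 'M[R[i]]_n),
    [/\ U \is unitarymx,
        toC A = U^t* *m diag_mx (toC r) *m U &
        char_poly A = \prod_(i < n) ('X - (r 0 i)%:P)].
Proof.
move=> Asym; pose B := toC A.
have Bherm : B \is hermsymmx.
  apply/is_hermitianmxP; rewrite expr0 scale1r; apply/matrixP => i j.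
  by rewrite !mxE -[in RHS]Asym mxE; apply/esym/conjc_real.
have /orthomx_spectralP BE := hermitian_normalmx Bherm.
have /mxOverP Dreal := hermitian_spectral_diag_real Bherm.
set P := spectralmx B in BE; set D := spectral_diag B in BE Dreal.
pose r : 'rV[R]_n := map_mx (@complex.Re R) D.
have DE : toC r = D.
  apply/rowP => i; rewrite !mxE; exact: RRe_real.
exists r, P; rewrite -invmx_unitary ?spectral_unitarymx// DE; split=> //.
apply: (map_poly_inj (real_complex R)).
rewrite map_char_poly (char_poly_conj (spectral_unit B) BE).
rewrite char_poly_trig ?diag_mx_is_trig// rmorph_prod.
apply: eq_bigr => i _ /=.
by rewrite -DE map_polyXsubC !mxE eqxx mulr1n.
Qed.

(** On either side [x] occurs as often as its multiplicity as a root. *)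
Lemma eigenvalues_perm (R : realType) (n : nat) (A : 'M[R]_n) (s : seq R) :
  char_poly A = \prod_(x <- s) ('X - x%:P) -> perm_eq (eigenvalues A) s.
Proof.
move=> pE; rewrite /eigenvalues perm_sort.
have p0 : char_poly A != 0 by rewrite monic_neq0 ?char_poly_monic.
apply/allP => x _; apply/eqP; rewrite -[RHS]mu_prod_XsubC -pE.
rewrite count_flatten -map_comp /= sumnE big_map.
have mx : (x \in rootsR (char_poly A)) = root (char_poly A) x.
  by rewrite -(roots_on_rootsR p0) in_itv.
have [xr|xnr] := boolP (x \in rootsR (char_poly A)).
  rewrite (big_rem x) //= count_nseq /= eqxx mul1n big1_seq ?addn0// => y.
  rewrite mem_rem_uniq ?uniq_roots// inE => /andP[_ /andP[yx _]].
  by rewrite count_nseq /= (negPf yx).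
rewrite mupNroot -?mx// big1_seq// => y /andP[_ yr].
by rewrite /= count_nseq /=; case: eqP xnr yr => // <- /negPf ->.
Qed.

Lemma unitarymx_dot (R : rcfType) (n : nat) (U : 'M[R[i]]_n) (v w : 'cV[R]_n) :
  U \is unitarymx ->
  \sum_i (U *m toC v) i 0 * ((U *m toC w) i 0)^* =
  real_complex R (\sum_i v i 0 * w i 0).
Proof.
move=> /unitarymxP; move/mulmx1C => UU.
set x := map_mx _ v; set y := map_mx _ w.
have -> : \sum_i (U *m x) i 0 * ((U *m y) i 0)^* = ((U *m y)^t* *m (U *m x)) 0 0.
  by rewrite mxE; apply: eq_bigr => i _; rewrite mulrC [in RHS]mxE [in RHS]mxE.
rewrite trmx_mul map_mxM mulmxA -(mulmxA (y^t*)) UU mulmx1 mxE rmorph_sum.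
apply: eq_bigr => i _; rewrite rmorphM mulrC !mxE; congr (_ * _).
exact: conjc_real.
Qed.

(** Multiplying a row vector by [A] cannot increase its l^1 norm, since the rows of [A] sum to 1. *)
Lemma stochastic_eigenvalue_le1 (R : realFieldType) (n : nat) (A : 'M[R]_n) (a : R) :
  (forall i j, 0 <= A i j) -> (forall i, \sum_j A i j = 1) ->
  eigenvalue A a -> `|a| <= 1.
Proof.
move=> A0 A1 /eigenvalueP[v vA v0].
have [i vi] : exists i, v 0 i != 0 by apply/rV0Pn.
have S0 : 0 < \sum_j `|v 0 j|.
  by rewrite (bigD1 i)//= ltr_pwDl ?normr_gt0// sumr_ge0.
rewrite -(ler_pM2r S0) mul1r mulr_sumr.
apply: (@le_trans _ _ (\sum_j \sum_i `|v 0 i| * A i j)).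
  apply: ler_sum => j _; rewrite -normrM.
  have -> : a * v 0 j = (v *m A) 0 j by rewrite vA mxE.
  rewrite mxE; apply: le_trans (ler_norm_sum _ _ _) _.
  by apply: ler_sum => k _; rewrite normrM (ger0_norm (A0 _ _)).
rewrite exchange_big; apply: ler_sum => k _.
by rewrite -mulr_sumr A1 mulr1.
Qed.

Lemma mem_eigenvalues (R : realType) (n : nat) (A : 'M[R]_n) (x : R) :
  x \in eigenvalues A -> eigenvalue A x.
Proof.
have p0 : char_poly A != 0 by rewrite monic_neq0 ?char_poly_monic.
rewrite mem_sort => /flattenP[_ /mapP[y yr ->]] /nseqP[-> _].
by move: yr; rewrite -(roots_on_rootsR p0) in_itv /= eigenvalue_root_char.
Qed.

(** For a transition matrix this is alpha = 1 - beta. *)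
Definition second_eigenvalue (R : realType) (n : nat) (A : 'M[R]_n) : R :=
  Num.max `|(eigenvalues A)`_1| `|(eigenvalues A)`_n.-1|.

Lemma second_eigenvalue_ge0 (R : realType) (n : nat) (A : 'M[R]_n) :
  0 <= second_eigenvalue A.
Proof. by rewrite le_max normr_ge0. Qed.

Lemma second_eigenvalue_le1 (R : realType) (n : nat) (A : 'M[R]_n) :
  (forall i j, 0 <= A i j) -> (forall i, \sum_j A i j = 1) ->
  second_eigenvalue A <= 1.
Proof.
move=> A0 A1; suff H k : `|(eigenvalues A)`_k| <= 1 by rewrite ge_max !H.
have [kl|kg] := ltnP k (size (eigenvalues A)); last first.
  by rewrite nth_default// normr0.
by apply: (stochastic_eigenvalue_le1 A0 A1); apply/mem_eigenvalues/mem_nth.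
Qed.

(** In the coordinates [U *m toC v] the matrix scales coordinate [i] by [r 0 i]. By Parseval it
    suffices that each coordinate vanishes or is scaled by at most alpha in modulus. *)
Lemma second_eigenvalue_contraction (R : realType) (n : nat) (A : 'M[R]_n)
    (v : 'cV[R]_n) :
  A^T = A -> (forall i j, 0 <= A i j) -> (forall i, \sum_j A i j = 1) ->
  \sum_i v i 0 = 0 ->
  \sum_i (A *m v) i 0 ^+ 2 <= second_eigenvalue A ^+ 2 * \sum_i v i 0 ^+ 2.
Proof.
move=> At A0 A1 v0; set alpha := second_eigenvalue A.
have alpha0 : 0 <= alpha by apply: second_eigenvalue_ge0.
have [r [U [Uu AE pE]]] := symmetric_spectral At.
have rle i : `|r 0 i| <= 1.
  apply: (stochastic_eigenvalue_le1 A0 A1); rewrite eigenvalue_root_char pE.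
  by rewrite (bigD1 i)//= rootM root_XsubC eqxx.
have ev_perm : perm_eq (eigenvalues A) [tuple r 0 i | i < n].
  apply: eigenvalues_perm; rewrite pE big_tuple.
  by apply: eq_bigr => i _; rewrite tnth_mktuple.
(* [p] sends a position in the sorted list to an index of [r]. *)
have [p pP] := tuple_permP ev_perm.
have nthE (i : 'I_n) : (eigenvalues A)`_i = r 0 (p i).
  by rewrite pP nth_mktuple tnth_mktuple.
have sz : size (eigenvalues A) = n by rewrite (perm_size ev_perm) size_tuple.
have srt : sorted >=%R (eigenvalues A) by apply/sort_sorted/ge_total.
(* Past position 0 an eigenvalue lies between the last one and lambda_1, so its sign decides which
   end bounds its modulus. *)
have small (i : 'I_n) : (0 < i)%N -> `|r 0 (p i)| <= alpha.
  move=> i0; rewrite -nthE /alpha /second_eigenvalue.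
  have le1 : (eigenvalues A)`_i <= (eigenvalues A)`_1.
    have := sorted_leq_nth ge_trans lexx 0 srt.
    by apply; rewrite ?inE ?sz//; apply: leq_ltn_trans (ltn_ord i).
  have le2 : (eigenvalues A)`_n.-1 <= (eigenvalues A)`_i.
    have := sorted_leq_nth ge_trans lexx 0 srt.
    by apply; rewrite ?inE ?sz// -ltnS prednK// (leq_ltn_trans _ (ltn_ord i)).
  have [s|s] := lerP 0 (eigenvalues A)`_i.
    by rewrite le_max ger0_norm// (le_trans le1)// ler_norm.
  rewrite le_max; apply/orP; right; rewrite ltr0_norm// -normrN.
  by apply: le_trans (ler_norm _); rewrite lerN2.
have UA (w : 'cV[R]_n) i :
    (U *m toC (A *m w)) i 0 = real_complex R (r 0 i) * (U *m toC w) i 0.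
  rewrite map_mxM AE !mulmxA (unitarymxP Uu) mul1mx.
  by rewrite -[_ *m U *m _]mulmxA mul_diag_mx !mxE.
pose c := U *m toC v.
(* [|r 0 i| > alpha] forces [r 0 i = lambda_0 = 1] to be a simple eigenvalue, so
   that its eigenvector is constant and orthogonal to [v]. *)
have key i : `|r 0 i| <= alpha \/ c i 0 = 0.
  have n0 : (0 < n)%N by apply: leq_ltn_trans (ltn_ord i).
  pose j0 := p (Ordinal n0).
  have small' j : j != j0 -> `|r 0 j| <= alpha.
    move=> jj0; rewrite -(permKV p j); apply: small; rewrite lt0n.
    apply: contra jj0 => /eqP j0E; rewrite /j0 -(permKV p j).
    by apply/eqP; congr (p _); apply: val_inj.
  have [|alt1] := lerP 1 alpha; first by left; apply: le_trans (rle i) _.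
  have [->|] := eqVneq i j0; last by left; apply: small'.
  right; pose one : 'cV[R]_n := const_mx 1; pose u := U *m toC one.
  have Aone : A *m one = one.
    apply/colP => k; rewrite !mxE -[RHS](A1 k).
    by apply: eq_bigr => l _; rewrite mxE mulr1.
  (* [A] fixes [one], so [u k 0] is annihilated by [1 - r 0 k], which is nonzero because alpha <
     1. *)
  have u0 k : k != j0 -> u k 0 = 0.
    move=> kj0; have := UA one k; rewrite Aone -/u => /eqP.
    rewrite -subr_eq0 -{1}[u k 0]mul1r -mulrBl mulf_eq0 => /orP[|/eqP//].
    rewrite subr_eq0 eq_sym (_ : 1 = real_complex R 1)// => /eqP/complexI rk1.
    by have := small' k kj0; rewrite rk1 normr1 leNgt alt1.
  (* Only coordinate [j0] of [u] can be nonzero, so orthogonality of [v] and [one] kills [c j0 0] or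
     [u j0 0]; the latter would make the norm of [one] zero. *)
  have uu := unitarymx_dot one one Uu; have cu := unitarymx_dot v one Uu.
  rewrite (bigD1 j0)//= big1 ?addr0 in cu; last first.
    by move=> k kj0; rewrite [X in _ * X^*]u0// conjC0 mulr0.
  have v1 : \sum_k v k 0 * one k 0 = 0.
    by rewrite -[RHS]v0; apply: eq_bigr => k _; rewrite mxE mulr1.
  move/eqP: cu; rewrite v1 rmorph0 mulf_eq0 conjC_eq0 => /orP[/eqP//|/eqP uj0].
  have : \sum_k one k 0 * one k 0 = 0.
    apply: (@complexI R); rewrite -uu rmorph0 big1// => k _.
    by have [->|kj0] := eqVneq k j0; rewrite ?[X in X * _]uj0 ?[X in X * _]u0 // mul0r.
  rewrite (eq_bigr (fun=> 1)); last by move=> k _; rewrite !mxE mulr1.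
  by rewrite sumr_const card_ord => /eqP; rewrite pnatr_eq0 -leqn0 leqNgt n0.
rewrite -lecR rmorphM /=.
under eq_bigr do rewrite expr2.
under [X in _ <= _ * real_complex R X]eq_bigr do rewrite expr2.
rewrite -!(unitarymx_dot _ _ Uu) mulr_sumr; apply: ler_sum => i _.
rewrite UA -/c -!normCK normrM exprMn.
have [ra|->] := key i; last by rewrite normr0 expr0n !mulr0.
rewrite ler_wpM2r ?exprn_ge0// normc_def /= expr0n addr0 sqrtr_sqr.
by rewrite -rmorphXn lecR lerXn2r ?nnegrE.
Qed.

End SymmetricSpectrum.

(** * Quadratic inequalities *)

Lemma sum_cauchy_schwarz (R : realFieldType) (I : finType) (P : pred I)
    (a b : I -> R) :
  (\sum_(i | P i) a i * b i) ^+ 2 <=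
  (\sum_(i | P i) a i ^+ 2) * \sum_(i | P i) b i ^+ 2.
Proof.
set C := \sum_(i | P i) a i * b i; set A := \sum_(i | P i) a i ^+ 2.
set B := \sum_(i | P i) b i ^+ 2.
have B0 : 0 <= B by apply: sumr_ge0 => i _; rewrite sqr_ge0.
(* Up to the factor [B], this is the component of [a] orthogonal to [b]. *)
have : 0 <= \sum_(i | P i) (a i * B - b i * C) ^+ 2.
  by apply: sumr_ge0 => i _; rewrite sqr_ge0.
have -> : \sum_(i | P i) (a i * B - b i * C) ^+ 2 = B * (A * B - C ^+ 2).
  rewrite (eq_bigr (fun i => a i ^+ 2 * B ^+ 2 + (a i * b i) * (- 2 * B * C)
     + b i ^+ 2 * C ^+ 2)); last by move=> i _; ring.
  by rewrite !big_split -!mulr_suml /= -/A -/B -/C; ring.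
move: B0; rewrite le_eqVlt => /orP[/eqP B0 _|B0]; last first.
  by rewrite pmulr_rge0// subr_ge0.
have b0 i : P i -> b i = 0.
  move/esym/eqP: B0; rewrite psumr_eq0 => [/allP b0 Pi|j _]; last exact: sqr_ge0.
  by apply/eqP; have := b0 i (mem_index_enum i); rewrite Pi sqrf_eq0.
by rewrite /C big1 ?expr0n ?mulr_ge0//= ?sumr_ge0// => i Pi;
  rewrite ?sqr_ge0// b0// mulr0.
Qed.

(** Root-free form of the AM-GM step: expand [X ^+ 2] as the square of [P + Q], bound the cross term
    using 4st <= (s + t)^2, and cancel one [X]. *)
Lemma weighted_quadratic_bound (R : realFieldType) (a b s t X Y P Q : R) :
  0 <= a -> 0 <= b -> 0 <= s -> 0 <= t -> 0 <= X -> 0 <= Y ->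
  X = P + Q -> P ^+ 2 <= b ^+ 2 * (s * t) * (X * Y) ->
  Q ^+ 2 <= a ^+ 2 * (X * Y) ->
  X <= (a + b * s) * (a + b * t) * Y.
Proof.
move=> a0 b0 s0 t0 X0 Y0 XE hP hQ.
have XY0 : 0 <= X * Y by apply: mulr_ge0.
have PQ : 2 * (P * Q) <= a * b * (s + t) * (X * Y).
  have D0 : 0 <= a * b * (s + t) * (X * Y) by rewrite !mulr_ge0 ?addr_ge0.
  apply: le_trans (ler_norm _) _.
  rewrite -(@ler_pXn2r _ 2)// ?nnegrE// real_normK ?num_real//.
  have : P ^+ 2 * Q ^+ 2 <= (b ^+ 2 * (s * t) * (X * Y)) * (a ^+ 2 * (X * Y)).
    by apply: ler_pM; rewrite ?sqr_ge0.
  have : 0 <= (a * b * (X * Y)) ^+ 2 * (s - t) ^+ 2 by rewrite mulr_ge0 ?sqr_ge0.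
  lra.
have XX : X * X <= X * ((a + b * s) * (a + b * t) * Y).
  by rewrite {1 2}XE; nra.
move: X0; rewrite le_eqVlt => /orP[/eqP <-|X0]; last by rewrite -(ler_pM2l X0).
by rewrite !mulr_ge0 ?addr_ge0 ?mulr_ge0.
Qed.

(** * The averaging operator of the graph and the one-step estimate *)

Lemma sum_enum_val (M : nmodType) (T : finType) (f : T -> M) :
  \sum_x f x = \sum_(i < #|T|) f (enum_val i).
Proof. by rewrite -(big_enum_val f). Qed.

Definition density (R : realType) (V : finType) (S : {set V}) : R :=
  #|S|%:R / #|V|%:R.

Definition gap_factor (R : realType) (V : finType) (e : rel V) (d : nat)
    (S : {set V}) : R :=
  (1 - spectral_gap R e d) + spectral_gap R e d * density R S.

Section Average.
Context (R : realType) (V : finType) (e : rel V) (d : nat).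
Hypotheses (e_sym : symmetric e) (e_reg : regular e d) (d_gt0 : (0 < d)%N).

Let beta := spectral_gap R e d.
Let alpha := 1 - beta.
Let N : R := #|V|%:R.

(** The action of the transition matrix on functions on [V], free of the enumeration of [V]. *)
Definition neighbour_avg (f : V -> R) (u : V) : R :=
  d%:R^-1 * \sum_(v | e u v) f v.

Let dd : d%:R^-1 * d%:R = 1 :> R.
Proof. by rewrite mulVf// pnatr_eq0 -lt0n. Qed.

Lemma neighbour_avg_cst (c : R) (u : V) : neighbour_avg (fun=> c) u = c.
Proof.
rewrite /neighbour_avg sumr_const -[#|_|](_ : d = _) -?(mulr_natl c).
  by rewrite mulrA dd mul1r.
by rewrite -(e_reg u) cardsE.
Qed.

(** By symmetry of [e] the columns of the transition matrix also sum to 1. *)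
Lemma sum_neighbour_avg (f : V -> R) :
  \sum_u neighbour_avg f u = \sum_u f u.
Proof.
rewrite -mulr_sumr (exchange_big_dep predT)//= mulr_sumr.
apply: eq_bigr => v _; rewrite -[RHS](neighbour_avg_cst (f v) v).
by congr (_ * _); apply: eq_bigl => u; rewrite e_sym.
Qed.

Let A := transition_mx R e d.

Lemma transition_mx_sym : A^T = A.
Proof. by apply/matrixP => i j; rewrite !mxE e_sym. Qed.

Lemma transition_mx_ge0 i j : 0 <= A i j.
Proof. by rewrite mxE; case: ifP => // _; rewrite invr_ge0. Qed.

Lemma mul_transition_mx (f : V -> R) (i : 'I_#|V|) :
  \sum_j A i j * f (enum_val j) = neighbour_avg f (enum_val i).
Proof.
rewrite /neighbour_avg mulr_sumr [RHS]big_mkcond /=.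
rewrite [RHS]sum_enum_val; apply: eq_bigr => j _.
by rewrite mxE; case: ifP; rewrite ?mul0r.
Qed.

Lemma transition_mx_row i : \sum_j A i j = 1.
Proof.
rewrite -[RHS](neighbour_avg_cst 1 (enum_val i)) -mul_transition_mx.
by apply: eq_bigr => j _; rewrite mulr1.
Qed.

Lemma subr_spectral_gap : alpha = second_eigenvalue A.
Proof. by rewrite /alpha /beta /spectral_gap opprB addrCA subrr addr0. Qed.

Lemma subr_spectral_gap_ge0 : 0 <= alpha.
Proof. by rewrite subr_spectral_gap second_eigenvalue_ge0. Qed.

Lemma spectral_gap_ge0 : 0 <= beta.
Proof.
suff : alpha <= 1 by rewrite /alpha lerBlDr lerDl.
rewrite subr_spectral_gap second_eigenvalue_le1//.
- exact: transition_mx_ge0.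
- exact: transition_mx_row.
Qed.

Lemma gap_factor_ge0 S : 0 <= gap_factor R e d S.
Proof.
rewrite addr_ge0 ?subr_spectral_gap_ge0// mulr_ge0 ?spectral_gap_ge0//.
by rewrite /density divr_ge0 ?ler0n.
Qed.

Lemma neighbour_avg_contraction (f : V -> R) : \sum_u f u = 0 ->
  \sum_u neighbour_avg f u ^+ 2 <= alpha ^+ 2 * \sum_u f u ^+ 2.
Proof.
move=> f0; rewrite subr_spectral_gap.
have := @second_eigenvalue_contraction _ _ A (\col_i f (enum_val i))
  transition_mx_sym transition_mx_ge0 transition_mx_row.
rewrite (sum_enum_val (fun u => neighbour_avg f u ^+ 2)).
rewrite (sum_enum_val (fun u => f u ^+ 2)) => bound.
have h i : (A *m \col_i0 f (enum_val i0)) i 0 = neighbour_avg f (enum_val i).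
  by rewrite mxE -mul_transition_mx; apply: eq_bigr => j _; rewrite [X in _ * X]mxE.
have hf i : (\col_i0 f (enum_val i0) : 'cV[R]_#|V|) i 0 = f (enum_val i).
  by rewrite mxE.
under [X in X <= _]eq_bigr => i _ do rewrite -h.
under [X in _ <= _ * X]eq_bigr => i _ do rewrite -hf.
apply: bound; rewrite -[RHS]f0 [RHS]sum_enum_val.
by apply: eq_bigr => i _; rewrite hf.
Qed.

Let mu (S : {set V}) : R := density R S.

(** The squared form of the bound on 1_T A 1_S. The mean [m] of [f] carries the beta J part, and the
    remainder [g] is the image of [f] under E. *)
Lemma neighbour_avg_restrict (f : V -> R) (S T : {set V}) :
  (forall x, x \notin S -> f x = 0) ->
  \sum_(u in T) neighbour_avg f u ^+ 2 <=
  gap_factor R e d S * gap_factor R e d T * \sum_u f u ^+ 2.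
Proof.
move=> f0.
have [V0|N0] := posnP #|V|.
  have noV (u : V) : false by have := card0_eq V0 u; rewrite !inE.
  by rewrite !big1 ?mulr0// => [u|u _]; have := noV u.
have N0' : 0 < N by rewrite ltr0n.
pose m := (\sum_u f u) / N.
pose h u := f u - m.
have sum_h : \sum_u h u = 0.
  by rewrite sumrB sumr_const -mulr_natl mulrC mulfVK ?subrr// gt_eqF.
have avgE u : neighbour_avg f u = neighbour_avg h u + m.
  rewrite -[X in _ + X](neighbour_avg_cst m u) -mulrDr -big_split /=.
  by congr (_ * _); apply: eq_bigr => v _; rewrite subrK.
pose g u := neighbour_avg h u + alpha * m.
set X := \sum_(u in T) _; set Y := \sum_u _.
have YE : Y = \sum_u h u ^+ 2 + N * m ^+ 2.
  rewrite /Y (eq_bigr (fun u => h u ^+ 2 + 2 * m * h u + m ^+ 2)); last first.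
    by move=> u _; rewrite /h; ring.
  by rewrite !big_split /= -mulr_sumr sum_h mulr0 addr0 sumr_const mulr_natl.
(* [neighbour_avg h] has sum zero, so it is orthogonal to the constant [alpha * m] and Pythagoras
   applies. *)
have g2 : \sum_u g u ^+ 2 <= alpha ^+ 2 * Y.
  rewrite (eq_bigr (fun u => neighbour_avg h u ^+ 2
    + 2 * (alpha * m) * neighbour_avg h u + (alpha * m) ^+ 2)); last first.
    by move=> u _; rewrite /g; ring.
  rewrite !big_split /= -mulr_sumr sum_neighbour_avg sum_h mulr0 addr0 sumr_const.
  rewrite YE mulrDr -mulr_natl exprMn mulrCA lerD2r.
  exact: neighbour_avg_contraction.
have X0 : 0 <= X by apply: sumr_ge0 => u _; rewrite sqr_ge0.
have Y0 : 0 <= Y by apply: sumr_ge0 => u _; rewrite sqr_ge0.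
have mu0 Q : 0 <= mu Q by rewrite /mu /density divr_ge0.
have b0 := spectral_gap_ge0; have a0 := subr_spectral_gap_ge0.
(* One factor of each square is split as [beta * m + g u]. *)
have XE : X = beta * m * \sum_(u in T) neighbour_avg f u
            + \sum_(u in T) neighbour_avg f u * g u.
  rewrite mulr_sumr -big_split; apply: eq_bigr => u _ /=.
  by rewrite /g avgE /alpha; ring.
apply: (weighted_quadratic_bound a0 b0 (mu0 S) (mu0 T) X0 Y0 XE).
  (* Cauchy-Schwarz on the support [S] of [f] yields the density of [S]; on [T] it will yield that
     of [T]. *)
  have m2 : m ^+ 2 <= #|S|%:R / N ^+ 2 * Y.
    rewrite exprMn exprVn [X in _ <= X]mulrAC ler_pM2r ?invr_gt0 ?exprn_gt0//.
    have -> : \sum_u f u = \sum_(u in S) 1 * f u.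
      rewrite [RHS]big_mkcond; apply: eq_bigr => u _ /=.
      by case: ifPn => [|/f0]; rewrite ?mul1r.
    apply: le_trans (sum_cauchy_schwarz _ _ _) _.
    under eq_bigr do rewrite expr1n.
    rewrite sumr_const ler_wpM2l ?ler0n//.
    rewrite big_mkcond; apply: ler_sum => u _; case: ifP => // _.
    exact: sqr_ge0.
  have T2 : (\sum_(u in T) neighbour_avg f u) ^+ 2 <= #|T|%:R * X.
    under eq_bigr do rewrite -[neighbour_avg f _]mul1r.
    apply: le_trans (sum_cauchy_schwarz _ _ _) _.
    by under eq_bigr do rewrite expr1n; rewrite sumr_const.
  set W := \sum_(u in T) _ in T2 *.
  have -> : (beta * m * W) ^+ 2 = beta ^+ 2 * (m ^+ 2 * W ^+ 2) by ring.
  rewrite -mulrA ler_wpM2l ?sqr_ge0//.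
  apply: le_trans (ler_pM _ _ m2 T2) _; rewrite ?sqr_ge0//.
  by rewrite le_eqVlt /mu /density; apply/orP; left; apply/eqP; field; rewrite gt_eqF.
apply: le_trans (sum_cauchy_schwarz _ _ _) _.
rewrite mulrCA ler_wpM2l//; apply: le_trans g2.
rewrite big_mkcond; apply: ler_sum => u _; case: ifP => // _.
exact: sqr_ge0.
Qed.

End Average.

(** * Tuples and lists *)

Lemma card_tuple_cons (T : finType) (n : nat) (P : pred (seq T)) :
  #|[set y : n.+1.-tuple T | P y]| =
  (\sum_x #|[set z : n.-tuple T | P (x :: z)]|)%N.
Proof.
under eq_bigr do rewrite -sum1_card.
rewrite -sum1_card pair_big_dep /=.
rewrite (reindex (fun xz : T * n.-tuple T => [tuple of xz.1 :: xz.2])) /=.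
  by apply: eq_bigl => -[x z]; rewrite !inE.
exists (fun y => (thead y, [tuple of behead y])).
  by move=> [x z] _; congr (_, _); apply: val_inj.
by move=> y _; rewrite -tuple_eta.
Qed.

(** Turns a condition indexed by time into one that unfolds along the list, as [walk_weight]
    does. *)
Lemma forall_tnth_all2 (S T : finType) (n : nat) (r : S -> T -> bool)
    (y : n.-tuple S) (U : 'I_n -> T) :
  [forall i, r (tnth y i) (U i)] = all2 r y [tuple U i | i < n].
Proof.
elim: n y U => [|n IHn] y U.
  rewrite tuple0 [[tuple U i | i < 0]]tuple0.
  by apply/forallP => -[].
case/tupleP: y => x y; rewrite /= enum_ordSl /=.
rewrite -[map U _](_ : val [tuple U (lift ord0 i) | i < n] = _); last first.
  by rewrite /= -map_comp.
rewrite -(IHn y); apply/forallP/andP => [H|[H0 /forallP H] i].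
  split; first by have := H ord0; rewrite tnth0.
  by apply/forallP => i; have := H (lift ord0 i); rewrite tnthS.
by case: (unliftP ord0 i) => [j ->|->]; rewrite ?tnthS ?tnth0.
Qed.

(** The default is [x] itself, so indices past the end are covered too. *)
Lemma nth_mktuple_cst (T : Type) (n : nat) (x : T) (f : 'I_n -> T) (j : nat) :
  (forall i : 'I_n, j = i -> f i = x) -> nth x [tuple f i | i < n] j = x.
Proof.
move=> fx; have [jn|nj] := ltnP j n; last by rewrite nth_default ?size_tuple.
by rewrite (nth_mktuple f x (Ordinal jn)) fx.
Qed.

(** * Weights of walks in the hybrid graph *)

Section WalkWeight.
Context (R : realType) (V : finType) (e : rel V) (d : nat) (F : {perm V}).
Hypotheses (e_sym : symmetric e) (e_reg : regular e d) (d_gt0 : (0 < d)%N).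
Hypothesis V_gt0 : (0 < #|V|)%N.

Let beta := spectral_gap R e d.
Let N : R := #|V|%:R.

Definition hybrid_avg (f : V -> R) (u : V) : R :=
  neighbour_avg e d (fun v => f (F v)) u.

(** [F] is injective, so each out-neighbour is [F v] for exactly one neighbour [v]. *)
Lemma sum_hybrid (f : V -> R) (u : V) :
  \sum_(w | hybrid e F u w) f w = d%:R * hybrid_avg f u.
Proof.
rewrite /hybrid_avg /neighbour_avg mulrA divff ?mul1r ?pnatr_eq0 -?lt0n//.
rewrite (reindex_inj (@perm_inj _ F)); apply: eq_bigl => v.
apply/existsP/idP => [[w /andP[ew /eqP/perm_inj->]]//|ev].
by exists v; rewrite ev eqxx.
Qed.

(* [walk_weight [:: S_0; ...; S_n] x] is the probability that a random walk on
   the hybrid graph started at [x] is in [S_i] at time [i] for all [i <= n]. *)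
Fixpoint walk_weight (Ts : seq {set V}) (x : V) : R :=
  if Ts is A :: Ts' then (x \in A)%:R * hybrid_avg (walk_weight Ts') x else 1.

(** Induction on the first step, each step contributing a factor [d]. *)
Lemma card_paths (Ts : seq {set V}) (n : nat) (x : V) : size Ts = n ->
  #|[set z : n.-tuple V | path (hybrid e F) x z &&
       all2 (fun v (S : {set V}) => v \in S) z Ts]|%:R =
  d%:R ^+ n * hybrid_avg (walk_weight Ts) x.
Proof.
elim: Ts n x => [|S Ts IHTs] [|n]//= x.
  move=> _; rewrite /hybrid_avg neighbour_avg_cst// mul1r.
  rewrite (_ : [set z | _] = setT) ?cardsT ?card_tuple//.
  by apply/setP => z; rewrite !inE tuple0.
move=> [sz]; rewrite exprSr -mulrA -sum_hybrid.
rewrite (card_tuple_cons _ (fun z => path (hybrid e F) x z &&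
  all2 (fun v (S : {set V}) => v \in S) z (S :: Ts))) natr_sum mulr_sumr.
rewrite [RHS]big_mkcond; apply: eq_bigr => w _ /=.
case: ifP => ew; last first.
  by rewrite (_ : [set z | _] = set0) ?cards0//; apply/setP => z; rewrite !inE.
have [wS|wS] := boolP (w \in S); last first.
  by rewrite mul0r mulr0 (_ : [set z | _] = set0) ?cards0//; apply/setP => z;
    rewrite !inE andbF.
by rewrite mul1r -IHTs.
Qed.

Lemma card_walks (Ts : seq {set V}) (t : nat) : size Ts = t.+1 ->
  #|[set y : t.+1.-tuple V | sorted (hybrid e F) y &&
       all2 (fun v (S : {set V}) => v \in S) y Ts]|%:R =
  d%:R ^+ t * \sum_x walk_weight Ts x.
Proof.
case: Ts => // S Ts [sz].
rewrite (card_tuple_cons _ (fun z => sorted (hybrid e F) z &&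
  all2 (fun v (S : {set V}) => v \in S) z (S :: Ts))) natr_sum mulr_sumr.
apply: eq_bigr => x _ /=.
have [xS|xS] := boolP (x \in S); last first.
  by rewrite mul0r mulr0 (_ : [set z | _] = set0) ?cards0//; apply/setP => z;
    rewrite !inE andbF.
by rewrite mul1r -card_paths.
Qed.

Lemma walk_weight_setT (Ts : seq {set V}) (x : V) :
  (forall j, nth setT Ts j = setT) -> walk_weight Ts x = 1.
Proof.
elim: Ts x => //= S Ts IHTs x allT.
rewrite (allT 0%N : S = _) inE mul1r -[RHS](neighbour_avg_cst e_reg d_gt0 1 x).
congr (_ * _); apply: eq_bigr => v _; apply: IHTs => j; exact: (allT j.+1).
Qed.

(** The uniform distribution is stationary: averaging and [F] both preserve sums, so the steps
    before time [i] drop out, and after it all weights are 1. *)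
Lemma sum_walk_weight_single (Ts : seq {set V}) (i : nat) :
  (i < size Ts)%N -> (forall j, j != i -> nth setT Ts j = setT) ->
  \sum_x walk_weight Ts x = #|nth setT Ts i|%:R.
Proof.
elim: Ts i => // S Ts IHTs [|i] /= ilt allT.
  rewrite -sum1_card natr_sum [RHS]big_mkcond; apply: eq_bigr => x _ /=.
  rewrite (_ : hybrid_avg _ _ = 1); first by case: ifP; rewrite mulr1.
  rewrite -[RHS](neighbour_avg_cst e_reg d_gt0 1 x).
  congr (_ * _); apply: eq_bigr => v _; apply: walk_weight_setT => j.
  exact: (allT j.+1).
rewrite -IHTs//; last by move=> j ji; apply: (allT j.+1).
rewrite [RHS](reindex_inj (@perm_inj _ F)) -[RHS](sum_neighbour_avg e_sym e_reg)//.
by apply: eq_bigr => x _; rewrite (allT 0%N _ : S = _)// inE mul1r.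
Qed.

Let c (S : {set V}) : R := gap_factor R e d S.
Let c0 (S : {set V}) : 0 <= c S := gap_factor_ge0 R e_reg d_gt0 S.

(** A step costs [c S] times the factor of the next set, so each set is charged by two steps. The
    leading factor is the charge still missing for the head; the default [setT] has factor 1. *)
Lemma walk_weight_norm (Ts : seq {set V}) :
  c (head setT Ts) * \sum_x walk_weight Ts x ^+ 2 <= N * \prod_(S <- Ts) c S ^+ 2.
Proof.
have N0 : N != 0 by rewrite pnatr_eq0 -lt0n.
elim: Ts => [|S Ts IHTs].
  rewrite big_nil /= (eq_bigr (fun=> 1)) => [|x _]; last by rewrite expr1n.
  rewrite sumr_const mulr1 (_ : c setT = 1) ?mul1r//.
  by rewrite /c /gap_factor /density cardsT divff// mulr1 subrK.
rewrite big_cons /= expr2 -mulrA [leRHS]mulrCA.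
apply: ler_wpM2l; first exact: c0.
rewrite [leRHS]mulrCA; apply: le_trans (ler_wpM2l (c0 S) IHTs).
have -> : \sum_x walk_weight (S :: Ts) x ^+ 2 =
    \sum_(x in S) neighbour_avg e d (fun v => walk_weight Ts (F v)) x ^+ 2.
  rewrite [RHS]big_mkcond; apply: eq_bigr => x _ /=.
  by case: ifP => _; rewrite ?mul1r// mul0r expr0n.
(* The support of the weight after composition with [F]. *)
pose S' := F @^-1: head setT Ts.
have supp x : x \notin S' -> walk_weight Ts (F x) = 0.
  by rewrite inE; case: Ts {IHTs} @S' => [|S1 Ts] /=; rewrite ?inE// => /negPf->; rewrite mul0r.
have := neighbour_avg_restrict e_sym e_reg d_gt0 S supp.
rewrite (_ : \sum_u _ ^+ 2 = \sum_u walk_weight Ts u ^+ 2); last first.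
  by rewrite [RHS](reindex_inj (@perm_inj _ F)).
have -> : gap_factor R e d S' = c (head setT Ts).
  by rewrite /c /gap_factor /density card_preimset//; apply: perm_inj.
by rewrite [_ * c S]mulrC mulrA.
Qed.

(** After squaring, Cauchy-Schwarz on the head set produces its density, which is at most the
    leading factor in [walk_weight_norm]. *)
Lemma walk_weight_bound (Ts : seq {set V}) : Ts != [::] ->
  N^-1 * \sum_x walk_weight Ts x <= \prod_(S <- Ts) c S.
Proof.
have N0 : 0 < N by rewrite ltr0n.
have P0 : 0 <= \prod_(S <- Ts) c S by apply: prodr_ge0.
case: Ts P0 => // S Ts P0 _; apply: le_trans (ler_norm _) _.
rewrite -(@ler_pXn2r _ 2)// ?nnegrE// real_normK ?num_real//.
have cS : #|S|%:R / N <= c S.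
  rewrite /c /gap_factor /density -/beta -/N -subr_ge0.
  have -> : 1 - beta + beta * (#|S|%:R / N) - #|S|%:R / N =
    (1 - beta) * (1 - #|S|%:R / N) by ring.
  rewrite mulr_ge0 ?subr_spectral_gap_ge0// subr_ge0 ler_pdivrMr// mul1r ler_nat.
  exact: max_card.
pose W := walk_weight (S :: Ts).
have CS : (\sum_x W x) ^+ 2 <= #|S|%:R * \sum_x W x ^+ 2.
  have -> : \sum_x W x = \sum_(x in S) 1 * W x.
    rewrite [RHS]big_mkcond; apply: eq_bigr => x _ /=; rewrite mul1r /W /=.
    by case: ifP => xS; rewrite ?xS ?mul0r.
  apply: le_trans (sum_cauchy_schwarz _ _ _) _.
  under eq_bigr do rewrite expr1n.
  rewrite sumr_const ler_wpM2l ?ler0n//.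
  rewrite big_mkcond; apply: ler_sum => u _; case: ifP => // _.
  exact: sqr_ge0.
have W0 : 0 <= \sum_x W x ^+ 2 by apply: sumr_ge0 => x _; apply: sqr_ge0.
rewrite exprMn -prodrXl.
apply: le_trans (ler_wpM2l (sqr_ge0 _) CS) _.
rewrite [leLHS](_ : _ = N^-1 * (#|S|%:R / N * \sum_x W x ^+ 2)); last by ring.
rewrite ler_pdivrMl//; apply: le_trans (walk_weight_norm _).
exact: ler_wpM2r.
Qed.

End WalkWeight.

(** * From counting walks to beta-independence *)

Lemma Pr_uniform_walk (R : realType) (V : finType) (e : rel V) (d : nat)
    (F : {perm V}) (t : nat) (T : 'I_t.+1 -> {set V}) :
  symmetric e -> regular e d -> (0 < d)%N -> (0 < #|V|)%N ->
  Pr (@uniform R (walk (hybrid e F) t))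
    [set w | [forall i, walk_proj i w \in T i]] =
  #|V|%:R^-1 * \sum_x walk_weight R e d F [tuple T i | i < t.+1] x.
Proof.
move=> e_sym e_reg d0 V0.
have cardE (T' : 'I_t.+1 -> {set V}) :
    #|[set w : walk (hybrid e F) t | [forall i, walk_proj i w \in T' i]]|%:R =
    d%:R ^+ t * \sum_x walk_weight R e d F [tuple T' i | i < t.+1] x.
  rewrite -card_walks ?size_tuple// -(card_imset _ val_inj); congr _%:R.
  apply: eq_card => y; rewrite [RHS]inE.
  rewrite -(forall_tnth_all2 (fun v (S : {set V}) => v \in S)).
  apply/imsetP/andP => [[w + ->]|[ys yT]].
    by rewrite inE => wT; split=> //; apply: (valP w).
  by exists (Sub y ys); rewrite ?inE// SubK.
(* The whole space is the event with every set equal to [setT]. *)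
have cardT : #|{: walk (hybrid e F) t}|%:R = d%:R ^+ t * #|V|%:R :> R.
  have -> : #|{: walk (hybrid e F) t}| =
      #|[set w : walk (hybrid e F) t | [forall i, walk_proj i w \in setT]]|.
    rewrite -cardsT; apply: eq_card => w; rewrite !inE.
    by apply/esym/forallP => i; rewrite inE.
  rewrite (cardE (fun=> setT)); congr (_ * _).
  rewrite (eq_bigr (fun=> 1)) ?sumr_const// => x _.
  by apply: (walk_weight_setT R F e_reg d0) => j; apply: nth_mktuple_cst.
rewrite /Pr /uniform sumr_const -[LHS]mulr_natl cardE cardT invfM mulrACA divff.
  by rewrite mul1r mulrC.
by rewrite expf_neq0// pnatr_eq0 -lt0n.
Qed.

Theorem theorem3p5 (R : realType) (V : finType) (e : rel V) (d : nat)
    (e_sym : symmetric e) (e_reg : regular e d) (e_conn : connected e)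
    (e_nbip : ~ bipartite e) (F : {perm V}) (t : nat) :
  beta_independent (@uniform R (walk (hybrid e F) t)) (spectral_gap R e d)
    (@walk_proj V (hybrid e F) t).
Proof.
(* Without edges, or without vertices, a constant colouring would be a bipartition. *)
have d0 : (0 < d)%N.
  rewrite lt0n; apply/eqP => d0; apply: e_nbip; exists (fun=> true) => u v euv.
  by move/eqP: (e_reg u); rewrite d0 cards_eq0 => /eqP/setP/(_ v); rewrite !inE euv.
have V0 : (0 < #|V|)%N.
  rewrite lt0n; apply/eqP => V0; apply: e_nbip; exists (fun=> true) => u v _.
  by have := card0_eq V0 u; rewrite !inE.
move=> T; rewrite (Pr_uniform_walk R F T e_sym e_reg d0 V0).
have marginal i : Pr (@uniform R (walk (hybrid e F) t))
    [set w | walk_proj i w \in T i] = density R (T i).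
  (* A marginal event is a joint event constrained only at time [i]. *)
  pose T' j := if j == i then T i else setT.
  rewrite (_ : [set w | _] = [set w | [forall j, walk_proj j w \in T' j]]).
    rewrite (Pr_uniform_walk R F T' e_sym e_reg d0 V0) mulrC; congr (_ / _).
    rewrite (sum_walk_weight_single R F e_sym e_reg d0 (i := i)) ?size_tuple//.
      by rewrite nth_mktuple /T' eqxx.
    move=> j ji; apply: nth_mktuple_cst => k jk; rewrite /T'.
    by case: eqP => // ki; rewrite jk ki eqxx in ji.
  apply/setP => w; rewrite !inE; apply/idP/forallP => [wi j|/(_ i)].
    by rewrite /T'; case: eqP => [->//|_]; rewrite inE.
  by rewrite /T' eqxx.
apply: le_trans (walk_weight_bound R F e_sym e_reg d0 V0 _) _.
  by rewrite -size_eq0 size_tuple.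
rewrite big_tuple le_eqVlt; apply/orP; left; apply/eqP.
by apply: eq_bigr => i _; rewrite tnth_mktuple marginal.
Qed.
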